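(* Let $f:\mathbb T\to\mathbb T$ be a Denjoy counter-example and let $\Lambda\subset\mathbb T$ be its Cantor minimal set. Let $\mathbf a=(a_n)_{n\ge1}$ be a (strictly increasing) subsequence of $\mathbb N$ with positive lower density $\underline D(\mathbf a)>0$. Then $f:\Lambda\to\Lambda$ is $\mathbf a$-mean Lyapunov stable.
   Context: $\mathbb T=\{z\in\mathbb C:|z|=1\}$ with its usual metric $d$. A Denjoy counter-example is an orientation-preserving homeomorphism $f$ of $\mathbb T$ with irrational rotation number $\rho\in(0,1)$ for which the continuous surjective map $h:\mathbb T\to\mathbb T$ with $h\circ f=R_\rho\circ h$, where $R_\rho(z)=e^{2\pi i\rho}z$ (Poincaré's semiconjugacy), is not a homeomorphism. For such $f$ there is a Cantor set $\Lambda=\Lambda_f\subset\mathbb T$ which is the minimal set of $f$: $f(\Lambda)=\Lambda$, and $f:\Lambda\to\Lambda$ is minimal (every orbit is dense in $\Lambda$) and uniquely ergodic. The lower density of $\mathbf a$, viewed as a subset of $\mathbb N$, is $\underline D(\mathbf a)=\liminf_{N\to\infty}\frac{\#(\mathbf a\cap[1,N])}{N}$. For $E\subset\mathbb N$, $\overline D_{\mathbf a}(E)=\limsup_{N\to\infty}\frac1N\#\{1\le n\le N:a_n\in E\}$. The map $f:\Lambda\to\Lambda$ is $\mathbf a$-mean Lyapunov stable if for every $\epsilon>0$ there is $\delta>0$ such that for all $x,y\in\Lambda$ with $d(x,y)<\delta$ there is a set $E\subset\mathbb N$ with $\overline D_{\mathbf a}(E)<\epsilon$ and $d(f^{a_n}x,f^{a_n}y)<\epsilon$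 for all $n\ge1$ with $a_n\notin E$. *)

(* Defs.v *)
From HB Require Import structures.
From mathcomp Require Import all_boot all_order all_algebra.
From mathcomp Require Import all_classical all_reals all_analysis.
From mathcomp.real_closed Require Import complex.

Set Implicit Arguments.
Unset Strict Implicit.
Unset Printing Implicit Defensive.

Import Order.TTheory GRing.Theory Num.Theory.
Import numFieldNormedType.Exports.

Local Open Scope classical_set_scope.
Local Open Scope ring_scope.

Definition circle (R : realType) := {z : R[i] | Normc.normc z == 1}.

HB.instance Definition _ (R : realType) :=
  Choice.copy (circle R) {z : R[i] | Normc.normc z == 1}.

Section CircleMetric.
Variable R : realType.
Implicit Types x y z : circle R.

Definition chord x y : R := Normc.normc (val x - val y).

Lemma chordxx x : chord x x = 0.
Proof. by rewrite /chord subrr Normc.normc0. Qed.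

Lemma chord_eq0 x y : chord x y = 0 -> x = y.
Proof. by move=> /Normc.eq0_normc/eqP; rewrite subr_eq0 => /eqP/val_inj. Qed.

Lemma chordC x y : chord x y = chord y x.
Proof. by rewrite /chord -normcN opprB. Qed.

Lemma chord_triangle y x z : chord x z <= chord x y + chord y z.
Proof. by rewrite /chord -(subrKA (val y)) le_normcD. Qed.

HB.instance Definition _ :=
  @isMetric.Build R (circle R) chord chordxx chord_eq0 chordC chord_triangle.

End CircleMetric.

Section Circle.
Variable R : realType.

Fact expi_subproof (t : R) :
  Normc.normc (Complex (cos (2 * pi * t)) (sin (2 * pi * t))) == 1.
Proof. by rewrite /= cos2Dsin2 sqrtr1. Qed.

(* t |-> e^{2 pi i t}, the covering map R -> T. *)
Definition expi (t : R) : circle R :=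
  exist (fun z : R[i] => Normc.normc z == 1) _ (expi_subproof t).

Fact rotation_subproof (rho : R) (z : circle R) :
  Normc.normc (val (expi rho) * val z) == 1.
Proof. by rewrite Normc.normcM (eqP (valP (expi rho))) (eqP (valP z)) mulr1. Qed.

Definition rotation (rho : R) (z : circle R) : circle R :=
  exist (fun z : R[i] => Normc.normc z == 1) _ (rotation_subproof rho z).

End Circle.

Definition homeomorphism (S T : topologicalType) (f : S -> T) :=
  continuous f /\
  exists g : T -> S, [/\ continuous g, cancel f g & cancel g f].

Section CircleDynamics.
Variable R : realType.
Implicit Types (f h : circle R -> circle R) (F : R -> R) (rho : R).

(* Lifts are those of degree-one maps, the only ones relevant to
   orientation-preserving homeomorphisms. *)
Definition is_lift f F :=
  [/\ continuous F, forall t, F (t + 1) = F t + 1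
    & forall t, f (expi t) = expi (F t)].

Definition orientation_preserving f :=
  exists2 F, is_lift f F & {homo F : s t / s < t}.

(* The rotation number is defined modulo 1: rho is one of its real
   representatives. *)
Definition has_rotation_number f rho :=
  exists2 F, is_lift f F &
    forall t, (fun n : nat => (iter n F t - t) / n%:R) @ \oo --> rho.

Definition semiconjugacy f rho h :=
  [/\ continuous h, set_surj [set: circle R] [set: circle R] h
    & h \o f = rotation rho \o h].

(* The semiconjugacy of a given f is unique up to a rotation of the target, so
   quantifying it existentially or universally is the same. *)
Definition denjoy_counterexample f :=
  [/\ homeomorphism f, orientation_preserving f
    & exists rho, [/\ 0 < rho < 1, irrational rho, has_rotation_number f rho
        & exists2 h, semiconjugacy f rho h & ~ homeomorphism h]].

(* cantor_like holds of the empty space, hence the nonemptiness clause. *)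
Definition cantor_minimal_set f (L : set (circle R)) :=
  [/\ L !=set0, cantor_like (set_type L), f @` L = L
    & forall x, L x -> L `<=` closure (range (fun n => iter n f x))].

End CircleDynamics.

Section Densities.
Variable R : realType.

(* #(A `&` [1, N]) / N *)
Definition frequency (A : set nat) (N : nat) : R :=
  (count (fun n => n \in A) (iota 1 N))%:R / N%:R.

(* Sequences are indexed from 1: the value a 0 is never used. *)
Definition lower_density (a : nat -> nat) : \bar R :=
  limn_einf (EFin \o frequency (a @` [set n | (0 < n)%N])).

Definition upper_density_along (a : nat -> nat) (E : set nat) : \bar R :=
  limn_esup (EFin \o frequency (a @^-1` E)).

Definition mean_lyapunov_stable (a : nat -> nat) (f : circle R -> circle R)
    (L : set (circle R)) :=
  forall e : R, 0 < e -> exists2 d : R, 0 < d &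
    forall x y, L x -> L y -> mdist x y < d ->
    exists2 E : set nat, (upper_density_along a E < e%:E)%E &
      forall n, (0 < n)%N -> ~ E (a n) ->
        mdist (iter (a n) f x) (iter (a n) f y) < e.

End Densities.

(* Main.v *)
Require Import Defs.
From mathcomp Require Import all_boot all_order all_algebra.
From mathcomp Require Import all_classical all_reals all_analysis.
From mathcomp Require Import complex ring lra zify.

Import Order.TTheory GRing.Theory Num.Theory.
Import numFieldNormedType.Exports.

Local Open Scope classical_set_scope.
Local Open Scope ring_scope.

Set Implicit Arguments.
Unset Strict Implicit.

(** Mean stability comes from two properties of f: it preserves the orientation
of the circle, and it has no periodic point.

Let I be the short arc between two nearby points x and y, and cut the circle
at M points p_1, ..., p_M, so finely that f^k x and f^k y are closer than e as
soon as the arc f^k I contains none of the p_j. Every bad time k is then a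
time at which some p_j lies in f^k I, that is f^-k p_j lies in I. If the same
p_j occurs at two bad times k < k', then f^(k' - k) maps one point of I to
another, and so moves it by less than the length of I. But f has no periodic
point, hence by compactness each of f, f^2, ..., f^m moves all points by at
least some d > 0 (lift_displacement_upto). If I is shorter than d, this forces
k' - k > m (no_early_return): the bad times split into M classes, each with
gaps larger than m (stretched_times_gap_union). Here M depends on e only,
while m is arbitrary.

It remains to see that such a set is rare along a sequence of positive lower
density c. Up to time a_N there are at most M (a_N / m + 1) bad times, and a_N
is at most N / c for N large, so the bad indices have upper density at most
M / (c m) (upper_density_gap_union); this is small once m is large.

The absence of periodic points comes from the rotation number: if f^k fixes a
point, then a lift F of f satisfies F^k t = t + n for some t and some integer
n, and the rotation number is n / k (irrational_rotation_aperiodic). *)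

(** * The covering of the circle by the line *)

Section CircleCovering.
Variable R : realType.
Implicit Types (s t u x d e : R) (z : circle R) (n : int).

(** The chord that subtends an arc of length 2 pi x, in a form which is visibly
continuous and monotone for x in [0, 1/2]. *)
Definition arc_chord x : R := Num.sqrt (2 - 2 * cos (2 * pi * x)).

Lemma chord_expi s t : chord (expi s) (expi t) = arc_chord (t - s).
Proof.
rewrite /chord /arc_chord /= mulrBr cosB.
congr (Num.sqrt _).
have := cos2Dsin2 (2 * pi * s); have := cos2Dsin2 (2 * pi * t).
set cs := cos _; set ss := sin _; set ct := cos _; set st := sin _ => h1 h2.
transitivity ((cs ^+ 2 + ss ^+ 2) + (ct ^+ 2 + st ^+ 2)
  - 2 * (ct * cs + st * ss)); last by rewrite h1 h2; ring.
by ring.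
Qed.

Lemma arc_chord0 : arc_chord 0 = 0.
Proof. by rewrite /arc_chord mulr0 cos0 mulr1 subrr sqrtr0. Qed.

Lemma arc_chord_norm x : arc_chord `|x| = arc_chord x.
Proof. by case: (ger0P x) => // _; rewrite /arc_chord mulrN cosN. Qed.

Lemma continuous_arc_chord : continuous arc_chord.
Proof.
move=> x; apply: continuous_comp; last exact: sqrt_continuous.
apply: cvgB; first exact: cvg_cst.
apply: cvgMr; apply: (@continuous_comp _ _ _ (fun y : R => 2 * pi * y) cos).
  by apply: cvgMr; exact: cvg_id.
exact: continuous_cos.
Qed.

Lemma arc_chord_lt s t : 0 <= s -> s < t -> t <= 2^-1 ->
  arc_chord s < arc_chord t.
Proof.
move=> s0 st t1; have pi0 := pi_gt0 R.
have hc : cos (2 * pi * t) < cos (2 * pi * s).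
  by rewrite ltr_cos ?in_itv /= -?(rwP andP) ?ltr_pM2l ?mulr_gt0//;
    [split; nra|split; nra].
have h1 := cos_geN1 (2 * pi * t); have h2 := cos_le1 (2 * pi * s).
by rewrite /arc_chord ltr_sqrt; lra.
Qed.

Lemma expiDz t n : expi (t + n%:~R) = expi t.
Proof.
have H1 u : expi (u + 1) = expi u.
  apply/val_inj => /=; congr Complex.
    by rewrite -[RHS]cosD2pi; congr cos; ring.
  by rewrite -[RHS]sinD2pi; congr sin; ring.
have H (m : nat) u : expi (u + m%:R) = expi u.
  elim: m u => [|m IH] u; first by rewrite addr0.
  by rewrite -natr1 addrA H1 IH.
case: n => m; first exact: H.
by rewrite NegzE mulrNz -[in RHS](subrK (m.+1%:R : R) t) H.
Qed.

Lemma expi_surj z : exists t, expi t = z.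
Proof.
have pi0 := pi_gt0 R; case: z => -[a b] /= hz.
have hab : a ^+ 2 + b ^+ 2 = 1.
  by rewrite -[RHS](expr1n R 2) -[in RHS](eqP hz) sqr_sqrtr ?addr_ge0 ?sqr_ge0.
have ha : -1 <= a <= 1 by apply/andP; split; nra.
pose u := if 0 <= b then acos a else - acos a.
exists (u / (2 * pi)); apply/val_inj => /=.
rewrite [_ * (u / _)]mulrC divfK ?gt_eqF ?mulr_gt0//.
have hs : sin (acos a) = `|b|.
  by rewrite sin_acos// -hab addrAC subrr add0r sqrtr_sqr.
rewrite /u; case: ger0P hs => hb hs; rewrite ?cosN ?sinN hs ?opprK acosK//.
Qed.

(** Some representative of a point of the circle is within half a turn of t,
where the chord determines the arc. *)
Lemma near_expi t x : exists2 n, expi (x + n%:~R) = expi x &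
  `|x + n%:~R - t| <= 2^-1.
Proof.
exists (- Num.floor (x - t + 2^-1)); first by rewrite expiDz.
have /andP[] := floor_itv (x - t + 2^-1).
rewrite mulrNz intrD => h1 h2.
by rewrite ler_norml; apply/andP; split; lra.
Qed.

Lemma expi_inj s t : expi s = expi t -> exists n, t = s + n%:~R.
Proof.
move=> st; have [n en hn] := near_expi s t.
exists (- n); rewrite mulrNz.
have : arc_chord `|t + n%:~R - s| = 0.
  by rewrite arc_chord_norm -chord_expi en -st chordxx.
have [|h] := eqVneq (t + n%:~R - s) 0; first by lra.
have := @arc_chord_lt 0 `|t + n%:~R - s| (lexx 0).
by rewrite normr_gt0 arc_chord0 => /(_ h hn) /[swap] ->; rewrite ltxx.
Qed.

Lemma chord_expi_small e : 0 < e ->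
  exists2 d, 0 < d & forall s t, `|t - s| < d -> chord (expi s) (expi t) < e.
Proof.
move=> e0; have := @continuous_arc_chord 0.
move/cvgrPdist_lt => /(_ _ e0) /nbhs_ballP[d /= d0 hd].
exists d => // s t st; rewrite chord_expi.
have : ball 0 d (t - s) by rewrite /ball /= sub0r normrN.
move/hd; rewrite /= arc_chord0 sub0r normrN.
exact: le_lt_trans (ler_norm _).
Qed.

(** Only some choice of the lifts is close: two lifts of one point may differ by
any integer. *)
Lemma close_lifts d : 0 < d ->
  exists2 e, 0 < e & forall x y : circle R, chord x y < e ->
    exists s t, [/\ expi s = x, expi t = y & `|t - s| < d].
Proof.
move=> d0; pose d' := Num.min d 2^-1.
have d'0 : 0 < d' by rewrite lt_min d0 invr_gt0 ltr0n.
have d'2 : d' <= 2^-1 by rewrite ge_min lexx orbT.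
exists (arc_chord d').
  by rewrite -[X in X < _]arc_chord0; exact: arc_chord_lt.
move=> x y; have [s <-] := expi_surj x; have [t <-] := expi_surj y.
have [n en hn] := near_expi s t; rewrite -en chord_expi -arc_chord_norm => h.
exists s, (t + n%:~R); split => //.
rewrite (@lt_le_trans _ _ d') ?ge_min ?lexx// ltNge.
apply/negP; rewrite le_eqVlt => /predU1P[dE|dlt].
  by rewrite -dE ltxx in h.
by have := lt_trans h (arc_chord_lt (ltW d'0) dlt hn); rewrite ltxx.
Qed.
End CircleCovering.

(** * Lifts of circle maps *)

Section Lifts.
Variable R : realType.
Implicit Types (f g : circle R -> circle R) (F G : R -> R).
Implicit Types (s t u d rho : R) (n : int) (k m : nat).

Lemma is_lift_iter f F k : is_lift f F -> is_lift (iter k f) (iter k F).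
Proof.
move=> [cF FD1 Fe]; elim: k => [|k [ckF kFD1 kFe]]; first by split=> // x.
split=> [x|t|t] /=; last by rewrite kFe Fe.
  by apply: continuous_comp; [exact: ckF | exact: cF].
by rewrite kFD1 FD1.
Qed.

Lemma lt_iter F k : {homo F : s t / s < t} -> {homo iter k F : s t / s < t}.
Proof. by move=> hF; elim: k => //= k IH s t st; apply/hF/IH. Qed.

Lemma liftDz f F t n : is_lift f F -> F (t + n%:~R) = F t + n%:~R.
Proof.
move=> [_ FD1 _].
have H (m : nat) u : F (u + m%:R) = F u + m%:R.
  elim: m u => [|m IH] u; first by rewrite !addr0.
  by rewrite -natr1 !addrA FD1 IH.
case: n => m; first exact: H.
by rewrite NegzE mulrNz -[in RHS](subrK (m.+1%:R : R) t) H addrK.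
Qed.

(** If f^k fixes the image of t, then F^k t = t + n, whence F^(jk) t = t + j n
for all j: along the multiples of k the averages that define the rotation
number are constantly n / k. *)
Lemma irrational_rotation_aperiodic f rho k z :
  has_rotation_number f rho -> irrational rho -> (0 < k)%N ->
  iter k f z != z.
Proof.
move=> [F lF hF] irr k0; apply/eqP => kz; apply: irr.
have [t tz] := expi_surj z.
have lkF := is_lift_iter k lF; have [_ _ kFe] := lkF.
have [n nE] : exists n : int, iter k F t = t + n%:~R.
  by apply: expi_inj; rewrite -kFe tz kz.
apply/rationalP; exists n, k.
have jF (j : nat) : iter (j * k) F t = t + j%:R * n%:~R.
  elim: j => [|j IH]; first by rewrite mul0r addr0.
  rewrite mulSn iterD IH.
  have -> : j%:R * n%:~R = (j%:Z * n)%:~R :> R by rewrite intrM.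
  by rewrite (liftDz _ _ lkF) nE -natr1 mulrDl mul1r intrM -addrA (addrC n%:~R).
have sub : (fun j : nat => (j.+1 * k)%N) @ \oo --> \oo.
  move=> A [N _ NA]; exists N => // j /= Nj; apply: NA => /=; nia.
have := cvg_comp _ _ sub (hF t).
have -> : (fun n0 : nat => (iter n0 F t - t) / n0%:R) \o
   (fun j : nat => (j.+1 * k)%N) = fun=> n%:~R / k%:R.
  apply/funext => j; rewrite [LHS]/comp jF addrAC subrr add0r natrM.
  by rewrite -mulf_div divff ?mul1r.
by move=> /cvg_lim <-//; rewrite lim_cst.
Qed.

(** The chord between t and G t is continuous, 1-periodic in t and never zero, so
it has a positive minimum over a period. *)
Lemma lift_displacement g G : is_lift g G -> (forall z, g z != z) ->
  exists2 d, 0 < d & forall t n, d <= `|G t - (t + n%:~R)|.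
Proof.
move=> lG ap; have [cG _ Ge] := lG.
have cphi : continuous (fun t => arc_chord (G t - t)).
  move=> t; apply: (@continuous_comp _ _ _ (fun t => G t - t) (@arc_chord R)).
    by apply: cvgB; [exact: cG | exact: cvg_id].
  exact: continuous_arc_chord.
have [||c _ cmin] := @EVT_min R (fun t => arc_chord (G t - t)) 0 1 => //.
  exact: continuous_subspaceT.
have c0 : 0 < chord (expi c) (g (expi c)).
  rewrite lt_neqAle eq_sym; apply/andP; split.
    by apply: contra (ap (expi c)) => /eqP/chord_eq0 <-.
  by rewrite Ge chord_expi sqrtr_ge0.
have [d d0 hd] := chord_expi_small c0.
exists d => // t n; rewrite leNgt; apply/negP => /hd.
rewrite expiDz.
(* Translate t to the period [0, 1]. *)
have -> : chord (expi t) (expi (G t)) =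
    arc_chord (G (t - (Num.floor t)%:~R) - (t - (Num.floor t)%:~R)).
  by rewrite -mulrNz (liftDz _ _ lG) chord_expi; congr arc_chord; ring.
have /andP[t1 t2] := floor_itv t.
rewrite Ge chord_expi ltNge cmin// in_itv/=.
by move: t2; rewrite intrD => t2; apply/andP; split; lra.
Qed.

Lemma lift_displacement_upto f F m : is_lift f F ->
  (forall k z, (0 < k)%N -> iter k f z != z) ->
  exists2 d, 0 < d & forall k t n, (0 < k <= m)%N ->
    d <= `|iter k F t - (t + n%:~R)|.
Proof.
move=> lF ap; elim: m => [|m [d d0 hd]].
  by exists 1 => // -[].
have [d' d'0 hd'] := lift_displacement (is_lift_iter m.+1 lF) (ap m.+1 ^~ isT).
exists (Num.min d d'); first by rewrite lt_min d0.
move=> k t n /andP[k0]; rewrite leq_eqVlt => /predU1P[->|km]; rewrite ge_min.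
  by rewrite hd' orbT.
by rewrite hd// k0.
Qed.

(** F^k and F^k' pull q and q + n back to points v and u of [s, t], and then
F^(k' - k) u = v + n: modulo 1, this iterate moves u by less than t - s. *)
Lemma no_early_return f F m d s t q n k k' : is_lift f F ->
  {homo F : s t / s < t} ->
  (forall k t n, (0 < k <= m)%N -> d <= `|iter k F t - (t + n%:~R)|) ->
  s <= t -> t - s < d ->
  iter k F s <= q <= iter k F t ->
  iter k' F s <= q + n%:~R <= iter k' F t ->
  (k < k')%N -> (m < k' - k)%N.
Proof.
move=> lF mF hd st std hq hqn kk'; rewrite ltnNge; apply/negP => km.
have hit j p : iter j F s <= p <= iter j F t ->
    exists2 u, s <= u <= t & iter j F u = p.
  move=> /andP[p1 p2]; have [cj _ _] := is_lift_iter j lF.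
  have [||u] := @IVT R (iter j F) s t p st.
  - exact: continuous_subspaceT.
  - by rewrite ge_min p1 le_max p2 orbT.
  by rewrite in_itv /= => ? ?; exists u.
have [v /andP[sv vt] vq] := hit _ _ hq.
have [u /andP[su ut] uq] := hit _ _ hqn.
have kinj : injective (iter k F).
  move=> a b ab; case: (ltgtP a b) => // /(lt_iter k mF); by rewrite ab ltxx.
have : iter (k' - k) F u = v + n%:~R.
  apply: kinj; rewrite -iterD subnKC ?(ltnW kk')// uq -vq.
  by rewrite (liftDz _ _ (is_lift_iter k lF)).
move=> uv; have := hd (k' - k)%N u n.
rewrite subn_gt0 kk' km => /(_ isT); rewrite uv leNgt => /negP; apply.
by rewrite ltr_norml; apply/andP; split; lra.
Qed.
End Lifts.

(** * Sets with large gaps and densities *)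

Section Densities.
Variable R : realType.
Implicit Types (a : nat -> nat) (E : set nat) (M m N : nat).

(** E is a union of M sets, the fibres of c, each with gaps at least m. *)
Definition gap_union M m E := exists2 c : nat -> nat, forall k, (c k < M)%N &
  forall k k', E k -> E k' -> c k = c k' -> (k < k')%N -> (m <= k' - k)%N.

Lemma sub_gap_union M m E E' : E `<=` E' -> gap_union M m E' -> gap_union M m E.
Proof. by move=> EE [c cM cE]; exists c => // k k' /EE kE /EE; exact: cE. Qed.

(** On E, the map k |-> (c k, k %/ m) is injective. *)
Lemma count_gap_union M m E B (l : seq nat) : (0 < m)%N -> gap_union M m E ->
  uniq l -> (forall k, k \in l -> (k <= B)%N) ->
  (count [in E] l <= M * (B %/ m).+1)%N.
Proof.
move=> m0 [c cM cE] ul lB; rewrite -size_filter.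
pose h k := (c k, k %/ m)%N.
rewrite -(size_map h) -[M](size_iota 0) -[(_ %/ _).+1](size_iota 0).
rewrite -(size_allpairs pair).
apply: uniq_leq_size.
  rewrite map_inj_in_uniq ?filter_uniq//.
  move=> k k'; rewrite !mem_filter.
  move=> /andP[/set_mem kE _] /andP[/set_mem k'E _].
  case=> ck km; case: (ltngtP k k') => // lt.
  - have := cE _ _ kE k'E ck lt.
    have := divn_eq k m; have := divn_eq k' m; rewrite km.
    by have := ltn_pmod k m0; have := ltn_pmod k' m0; lia.
  - have := cE _ _ k'E kE (esym ck) lt.
    have := divn_eq k m; have := divn_eq k' m; rewrite km.
    by have := ltn_pmod k m0; have := ltn_pmod k' m0; lia.
move=> _ /mapP[k + ->]; rewrite mem_filter => /andP[_ kl].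
apply/allpairsP; exists (h k); rewrite !mem_iota !add0n /=; split => //.
by rewrite ltnS leq_div2r ?lB.
Qed.

Lemma limn_einf_gt (u : nat -> R) (r : R) : (r%:E < limn_einf (EFin \o u))%E ->
  exists2 r', r < r' & exists N0, forall N, (N0 <= N)%N -> r' <= u N.
Proof.
rewrite limn_einf_lim (cvg_lim _ (@cvg_einfs_sup _ _))//.
move=> /ereal_sup_gt[_ [N0 _ <-]] ru.
have le N : (N0 <= N)%N -> (einfs (EFin \o u) N0 <= (u N)%:E)%E.
  by move=> N0N; apply: ereal_inf_lbound; exists N.
have fin : einfs (EFin \o u) N0 \is a fin_num.
  rewrite fin_real// (lt_trans _ ru) ?ltNyr//=.
  by rewrite (le_lt_trans (le _ (leqnn _))) ?ltry.
exists (fine (einfs (EFin \o u) N0)); first by rewrite -lte_fin fineK.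
by exists N0 => N /le; rewrite -lee_fin fineK.
Qed.

Lemma limn_esup_le (u : nat -> R) (r : R) N0 :
  (forall N, (N0 <= N)%N -> u N <= r) -> (limn_esup (EFin \o u) <= r%:E)%E.
Proof.
move=> ur; rewrite limn_esup_lim (cvg_lim _ (@cvg_esups_inf _ _))//.
apply: ge_ereal_inf; exists (esups (EFin \o u) N0); first by exists N0.
by apply: ge_ereal_sup => _ [N /= N0N <-]; rewrite lee_fin ur.
Qed.

Section IncreasingSequence.
Variable a : nat -> nat.
Hypothesis a_incr : forall m n, (0 < m)%N -> (m < n)%N -> (a m < a n)%N.

Let a_leq m n : (0 < m)%N -> (0 < n)%N -> (a m <= a n)%N = (m <= n)%N.
Proof.
move=> m0 n0; case: (ltngtP m n) => [mn|nm|->]; last exact: leqnn.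
- exact/ltnW/a_incr.
- by apply/negbTE; rewrite -ltnNge a_incr.
Qed.

Let uniq_a N : uniq [seq a n | n <- iota 1 N].
Proof.
rewrite map_inj_in_uniq ?iota_uniq// => i j; rewrite !mem_iota.
move=> /andP[i0 _] /andP[j0 _] aij; apply/eqP.
by rewrite eqn_leq -(a_leq i0 j0) -(a_leq j0 i0) aij leqnn.
Qed.

(** Apply the lower density at the times a_N: exactly the first N terms of the
sequence are at most a_N, and a 1 may be 0, hence outside of [1, a_N]. *)
Lemma pos_lower_density_linear : (0 < lower_density R a)%E ->
  exists2 c : R, 0 < c &
    exists N0, forall N, (N0 <= N)%N -> c * (a N)%:R <= N%:R.
Proof.
move=> /limn_einf_gt[c c0 [N0 hN0]]; exists c => //; exists N0.+2 => N NN0.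
have aN : (N0 < a N)%N.
  have H n : (n <= a n.+1)%N.
    by elim: n => // n IH; apply: (leq_ltn_trans IH); exact: a_incr.
  by case: N NN0 => // N NN0; apply: leq_trans (H N).
have := hN0 _ (ltnW aN); rewrite /frequency ler_pdivlMr; last first.
  by rewrite ltr0n (leq_ltn_trans _ aN).
move=> /le_trans; apply; rewrite ler_nat.
rewrite -size_filter -[leqRHS](size_iota 1) -[leqRHS](size_map a).
apply: uniq_leq_size; first by rewrite filter_uniq// iota_uniq.
move=> _ /[!mem_filter] /andP[/set_mem[j /= j0 <-]].
rewrite mem_iota => /andP[_].
rewrite add1n ltnS a_leq// => [jN|]; last by case: N NN0 {aN}.
by apply/mapP; exists j; rewrite // mem_iota j0 add1n ltnS.
Qed.

(** By count_gap_union and pos_lower_density_linear the frequency at N is at most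
M / (c m) + M / N; m is chosen to make the first term less than e / 3, and
the second one is so for N large. *)
Lemma upper_density_gap_union M (e : R) : 0 < e -> (0 < lower_density R a)%E ->
  exists2 m, (0 < m)%N & forall E, gap_union M m E ->
    (upper_density_along R a E < e%:E)%E.
Proof.
move=> e0 /pos_lower_density_linear[c c0 [N0 hN0]].
have [m mE] : exists m : nat, M%:R / c < (e / 3) * m.+1%:R.
  exists (Num.trunc ((e / 3)^-1 * (M%:R / c))).
  by rewrite -ltr_pdivrMl ?divr_gt0// truncnS_gt.
have [N1 NE] : exists N1 : nat, M%:R < (e / 3) * N1.+1%:R.
  exists (Num.trunc ((e / 3)^-1 * M%:R)).
  by rewrite -ltr_pdivrMl ?divr_gt0// truncnS_gt.
exists m.+1 => // E gE; apply: (@le_lt_trans _ _ (2 * (e / 3))%:E); last first.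
  by rewrite lte_fin; lra.
apply: (@limn_esup_le _ _ (N0 + N1).+1) => N hN.
have N_gt0 : 0 < N%:R :> R by rewrite ltr0n; lia.
rewrite /frequency ler_pdivrMr//.
have cnt : (count (fun n => n \in a @^-1` E) (iota 1 N)
    <= M * (a N %/ m.+1).+1)%N.
  rewrite (eq_count (a2 := preim a [in E])); last first.
    by move=> n /=; apply/idP/idP => /set_mem ?; apply/mem_set.
  rewrite -count_map; apply: count_gap_union => //.
  move=> _ /mapP[n + ->]; rewrite mem_iota => /andP[n0 nN].
  by rewrite a_leq; lia.
apply: (@le_trans _ _ (M * (a N %/ m.+1).+1)%:R); first by rewrite ler_nat.
have {}hN0 := hN0 N ltac:(lia).
have dv : (a N %/ m.+1)%:R * m.+1%:R <= (a N)%:R :> R.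
  by rewrite -natrM ler_nat leq_divM.
have NN : N1.+1%:R <= N%:R :> R by rewrite ler_nat; lia.
rewrite natrM -natr1 mulrDr mulr1 mulr2n mulrDl mul1r mulrDl lerD//; last first.
  by rewrite (le_trans (ltW NE))// ler_pM2l// divr_gt0.
have m0 : 0 < m.+1%:R :> R by rewrite ltr0n.
rewrite -(ler_pM2r m0) -mulrA.
apply: (@le_trans _ _ (M%:R / c * N%:R)).
  rewrite -mulrA ler_wpM2l// ler_pdivlMl//.
  exact: le_trans (ler_wpM2l (ltW c0) dv) hN0.
by rewrite [leRHS]mulrAC ler_pM2r// ltW.
Qed.
End IncreasingSequence.
End Densities.

(** * Mean stability *)

Section MeanStability.
Variable R : realType.

(** At a time k when [F^k s, F^k t] has length at least 1 / M, this interval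
contains some multiple z / M of 1 / M; the class of k is the residue of z
modulo M, which names the point of the circle below z / M. *)
Lemma stretched_times_gap_union (f : circle R -> circle R) (F : R -> R)
    (M m : nat) (d s t : R) : (0 < M)%N -> is_lift f F ->
  {homo F : s t / s < t} ->
  (forall k t n, (0 < k <= m)%N -> d <= `|iter k F t - (t + n%:~R)|) ->
  s <= t -> t - s < d ->
  gap_union M m.+1 [set k | M%:R^-1 <= iter k F t - iter k F s].
Proof.
move=> M0 lF mF hd st std; have MR0 : 0 < M%:R :> R by rewrite ltr0n.
pose z k := Num.floor (M%:R * iter k F t).
have zin k : M%:R^-1 <= iter k F t - iter k F s ->
    iter k F s <= (z k)%:~R / M%:R <= iter k F t.
  move=> hk; have /andP[z1 z2] := floor_itv (M%:R * iter k F t).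
  rewrite ler_pdivrMr// [iter k F t * _]mulrC z1 andbT ler_pdivlMr//.
  move: z2 hk; rewrite intrD -(ler_pM2r MR0) mulVf ?gt_eqF// mulrBl /z; lra.
have Mz : M%:Z != 0 by rewrite -lt0n.
exists (fun k => absz (z k %% M)%Z) => [k|k k' kE k'E ck kk'].
  by rewrite -ltz_nat gez0_abs ?modz_ge0// ltz_pmod.
have {}ck : (z k %% M)%Z = (z k' %% M)%Z.
  by rewrite -[LHS]gez0_abs ?modz_ge0// -[RHS]gez0_abs ?modz_ge0// ck.
pose n := ((z k' %/ M)%Z - (z k %/ M)%Z).
have zE : z k' = z k + n * M%:Z.
  have := divz_eq (z k') M; have := divz_eq (z k) M; rewrite /n ck.
  move: (_ %/ _)%Z (_ %/ _)%Z (_ %% _)%Z => p p' r -> ->; ring.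
apply: (@no_early_return _ f F m d s t ((z k)%:~R / M%:R) n) => //.
  exact: zin.
have -> : (z k)%:~R / M%:R + n%:~R = (z k')%:~R / M%:R :> R.
  by rewrite zE intrD intrM mulrDl -pmulrn mulfK ?gt_eqF.
exact: zin.
Qed.

(** The number M of marked points depends on e through uniform continuity of the
covering; the gap m is chosen after M, and the closeness d2 of the two points
after m. *)
Theorem aperiodic_circle_homeo_mean_stable (f : circle R -> circle R)
    (a : nat -> nat) :
  orientation_preserving f ->
  (forall k z, (0 < k)%N -> iter k f z != z) ->
  (forall m n, (0 < m)%N -> (m < n)%N -> (a m < a n)%N) ->
  (0 < lower_density R a)%E ->
  mean_lyapunov_stable a f [set: circle R].
Proof.
move=> [F lF mF] ap a_incr da e e0.
have [d1 d10 hd1] := @chord_expi_small R e e0.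
pose M := (Num.trunc d1^-1).+1.
have MR0 : 0 < M%:R :> R by rewrite ltr0n.
have Md1 : M%:R^-1 < d1.
  by rewrite -[ltRHS]invrK ltf_pV2 ?posrE ?invr_gt0// truncnS_gt.
have [[//|m] _ hm] := upper_density_gap_union a_incr M e0 da.
have [d d0 hd] := lift_displacement_upto m lF ap.
have [d2 d20 hd2] := close_lifts d0.
pose far x y := [set k | e <= chord (iter k f x) (iter k f y)].
have far_rare s t : s <= t -> t - s < d ->
    (upper_density_along R a (far (expi s) (expi t)) < e%:E)%E.
  move=> st std; apply: hm.
  apply: sub_gap_union
    (stretched_times_gap_union (M := M) _ lF mF hd st std) => //.
  move=> k; have [_ _ kFe] := is_lift_iter k lF.
  rewrite /far /= !kFe; apply: contraTT; rewrite -!ltNge => Fk.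
  apply: hd1; rewrite ger0_norm ?subr_ge0; first exact: lt_trans Fk Md1.
  by move: st; rewrite le_eqVlt => /predU1P[->//|/(lt_iter k mF)/ltW].
(* The lifts may come in either order, but far is symmetric. *)
exists d2 => // x y _ _ /hd2[s [t [sx ty std]]].
exists (far x y); last by move=> n _ /= /negP; rewrite -ltNge.
rewrite -sx -ty; have [st|ts] := leP s t.
  by apply: far_rare => //; exact: le_lt_trans (ler_norm _) std.
rewrite [far _ _](_ : _ = far (expi t) (expi s)).
  apply: far_rare (ltW ts) _; rewrite distrC in std.
  exact: le_lt_trans (ler_norm _) std.
by apply/funext => k; rewrite /far /= chordC.
Qed.
End MeanStability.

(** An irrational rotation number excludes periodic points, and stability on the
whole circle restricts to L. *)
Theorem corollary2 (R : realType) (f : circle R -> circle R)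
    (L : set (circle R)) (a : nat -> nat)
    (hf : denjoy_counterexample f)
    (hL : cantor_minimal_set f L)
    (ha : forall m n : nat, (0 < m)%N -> (m < n)%N -> (a m < a n)%N)
    (hd : (0 < lower_density R a)%E) :
  mean_lyapunov_stable a f L.
Proof.
have [_ opf [rho [_ irr rotf _]]] := hf => e e0.
have ap k z : (0 < k)%N -> iter k f z != z.
  exact: irrational_rotation_aperiodic rotf irr.
have [d d0 hd'] := aperiodic_circle_homeo_mean_stable opf ap ha hd e0.
by exists d => // x y _ _; exact: hd'.
Qed.
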